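(* Let $D(z)=\frac{\partial}{\partial z}C_{123}(0,z)$, where $C_{123}(0,z)=\sum_{n\ge0}a_n\frac{z^n}{n!}$ and $a_n$ is the number of circular permutations of length $n$ that avoid the consecutive pattern $123$. Then, as formal power series in $z$, $$D'(z)=D(z)^2-D(z)+1.$$
   Context: $\mathfrak{S}_n$ denotes the set of permutations $\pi=\pi_1\cdots\pi_n$ of $\{1,\dots,n\}$ in one-line notation ($\mathfrak{S}_0$ consists of the empty permutation). For $\pi\in\mathfrak{S}_n$, $[\pi]$ is the set of all rotations $\pi_i\pi_{i+1}\cdots\pi_n\pi_1\cdots\pi_{i-1}$ of $\pi$, called a circular permutation of length $n$; $[\mathfrak{S}_n]$ is the set of all circular permutations of length $n$ (equivalence classes of $\mathfrak{S}_n$ under rotation). $[\mathfrak{S}_0]$ has exactly one element, which avoids every pattern. A circular permutation $[\pi]\in[\mathfrak{S}_n]$ avoids the consecutive pattern $123$ if no rotation $\pi'=\pi'_1\cdots\pi'_n\in[\pi]$ has an index $1\le i\le n-2$ with $\pi'_i<\pi'_{i+1}<\pi'_{i+2}$. Prime denotes the derivative with respect to $z$ when applied to $D$. *)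

(* Defs.v *)
From HB Require Import structures.
From mathcomp Require Import all_boot all_order all_fingroup all_algebra.

Set Implicit Arguments.
Unset Strict Implicit.
Unset Printing Implicit Defensive.

Import GRing.Theory.

Local Open Scope nat_scope.

(* One-line notation, with letters 0, ..., n-1 instead of 1, ..., n. *)
Definition one_line (n : nat) (pi : 'S_n) : seq nat :=
  [seq val (pi i) | i <- enum 'I_n].

(* The index k runs over 0, ..., n (the rotations by 0 and by n coincide), so
   that the class of the empty permutation contains the empty permutation. *)
Definition rotations (n : nat) (pi : 'S_n) : {set 'S_n} :=
  [set s : 'S_n | [exists k : 'I_n.+1, one_line s == rot k (one_line pi)]].

Definition circular_perms (n : nat) : {set {set 'S_n}} :=
  [set rotations pi | pi : 'S_n].

(* There is no such index i when size w <= 2. *)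
Definition contains_consecutive_123 (w : seq nat) : bool :=
  [exists i : 'I_(size w - 2),
     (nth 0 w i < nth 0 w i.+1) && (nth 0 w i.+1 < nth 0 w i.+2)].

Definition circular_avoids_123 (n : nat) (c : {set 'S_n}) : bool :=
  [forall (s | s \in c), ~~ contains_consecutive_123 (one_line s)].

Definition num_circular_avoiding_123 (n : nat) : nat :=
  #|[set c in circular_perms n | circular_avoids_123 c]|.

Local Open Scope ring_scope.

(* A formal power series is its sequence of coefficients, so equality of series
   is pointwise equality of functions. *)
Definition fps : Type := nat -> rat.

Definition fps_one : fps := fun n => (n == 0%N)%:R.
Definition fps_add (f g : fps) : fps := fun n => f n + g n.
Definition fps_sub (f g : fps) : fps := fun n => f n - g n.
Definition fps_mul (f g : fps) : fps :=
  fun n => \sum_(i < n.+1) f i * g (n - i)%N.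
Definition fps_deriv (f : fps) : fps := fun n => n.+1%:R * f n.+1.

Declare Scope fps_scope.
Delimit Scope fps_scope with fps.
Bind Scope fps_scope with fps.
Notation "1" := fps_one : fps_scope.
Notation "f + g" := (fps_add f g) : fps_scope.
Notation "f - g" := (fps_sub f g) : fps_scope.
Notation "f * g" := (fps_mul f g) : fps_scope.

Definition egf (a : nat -> nat) : fps := fun n => (a n)%:R / (n`!)%:R.

(* C_{123}(0, z), as a power series in z. *)
Definition C123_0 : fps := egf num_circular_avoiding_123.

Definition D123 : fps := fps_deriv C123_0.

(* Main.v *)
Require Import Defs.
From mathcomp Require Import all_boot all_order all_fingroup all_algebra.

Set Implicit Arguments.
Unset Strict Implicit.
Unset Printing Implicit Defensive.

Local Open Scope nat_scope.

(** Rotate every circular permutation of length [n.+1] so that its largest letter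
    comes last.  No increasing triple can have that letter in its middle or at
    its start, so the circular permutation avoids 123 exactly when the word
    [w infinity] does, where [w] is the arrangement of the other [n] letters and
    [infinity] stands for any letter larger than all of them.  Hence
    [D = sum_n d_n z^n / n!], where [d_n] counts the arrangements [w] of [n]
    letters for which [w infinity] avoids 123 ([num_circular_avoiding_123S]).

    Cut such a [w], with [n.+1] letters, at its own maximum: [w = u m v].  The
    letter [m] plays the role of [infinity] for [u], and [m v infinity] avoids 123
    exactly when [v infinity] does; the only interaction between the two sides
    is that an empty [v] after a nonempty [u] produces the rise
    [x < m < infinity].  So every pair [(u, v)] of good arrangements occurs, on any
    splitting of the [n] remaining letters, except those with [v] empty and [u]
    nonempty ([nwords_cut_at_max]), and
    [d_(n+1) = sum_i C(n, i) d_i d_(n-i) - d_n + [n = 0]].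
    Divided by [n!], this is the coefficient of [z^n] in [D' = D^2 - D + 1]. *)

(** * Words avoiding 123 *)
Definition avoids_123 (w : seq nat) : bool := ~~ contains_consecutive_123 w.

(** A triple that runs past the end of the word has the default value 0 as its
    last letter, so it is not increasing; hence [i] can range over all naturals. *)
Lemma avoids_123P (w : seq nat) :
  reflect (forall i, ~~ (nth 0 w i < nth 0 w i.+1 < nth 0 w i.+2))
          (avoids_123 w).
Proof.
rewrite /avoids_123 /contains_consecutive_123.
apply: (iffP existsPn) => [av i|av i]; last exact: av.
have [i_lt|i_ge] := ltnP i (size w - 2); first exact: (av (Ordinal i_lt)).
by rewrite (@nth_default _ 0 w i.+2) ?ltn0 ?andbF // -[i.+2]add2n -leq_subLR.
Qed.

Lemma avoids_123_nil : avoids_123 [::].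
Proof. by apply/avoids_123P => i; rewrite !nth_nil. Qed.

Lemma avoids_123_cons (x : nat) (w : seq nat) :
  avoids_123 (x :: w) = ~~ (x < nth 0 w 0 < nth 0 w 1) && avoids_123 w.
Proof.
apply/avoids_123P/andP => [av|[avx /avoids_123P av] [|i]] //; last exact: av.
by split; [exact: (av 0) | apply/avoids_123P => i; exact: (av i.+1)].
Qed.

Lemma avoids_123_catr (u v : seq nat) : avoids_123 (u ++ v) -> avoids_123 v.
Proof. by elim: u => //= x u IHu; rewrite avoids_123_cons => /andP[_ /IHu]. Qed.

Lemma avoids_123_catl (u v : seq nat) : avoids_123 (u ++ v) -> avoids_123 u.
Proof.
elim: u => [_|x u IHu /=]; first exact: avoids_123_nil.
rewrite !avoids_123_cons => /andP[+ /IHu ->]; rewrite andbT.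
by case: u {IHu} => [|y [|z u]]; rewrite //= ?ltn0 ?andbF.
Qed.

(** A descent from [m] to [y] separates the word: a triple that contains both
    letters is not increasing, and one that contains [m] but not [y] ends in [m]. *)
Lemma avoids_123_descent (u v : seq nat) (m y : nat) : y < m ->
  avoids_123 (u ++ m :: y :: v) = avoids_123 (rcons u m) && avoids_123 (y :: v).
Proof.
move=> lt_ym; elim: u => [|x u IHu] /=.
  rewrite !avoids_123_cons /= [m < y]ltnNge (ltnW lt_ym) ?ltn0 /=.
  by rewrite ?andbF avoids_123_nil.
rewrite !(avoids_123_cons x) IHu andbA; congr (~~ _ && _ && _).
by case: u {IHu} => [|z [|z' u]] //=; rewrite ltn0 [m < y]ltnNge (ltnW lt_ym).
Qed.

Lemma avoids_123_peak (u v : seq nat) (m : nat) : all (gtn m) v ->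
  avoids_123 (u ++ m :: v) = avoids_123 (rcons u m) && avoids_123 v.
Proof.
case: v => [_|y v /andP[lt_ym _]]; last exact: avoids_123_descent.
by rewrite cats1 avoids_123_nil andbT.
Qed.

(** Only the fact that the last letter exceeds all others matters, so every upper
    bound of [u] can serve as the infinite letter. *)
Lemma avoids_123_rcons_max (u : seq nat) (m M : nat) :
  all (gtn m) u -> all (gtn M) u ->
  avoids_123 (rcons u m) = avoids_123 (rcons u M).
Proof.
elim: u => [|x u IHu] /=.
  by rewrite !avoids_123_cons /= ?ltn0 ?andbF.
move=> /andP[lt_xm ltm] /andP[lt_xM ltM].
rewrite !(avoids_123_cons x) IHu //; congr (~~ _ && _).
case: u ltm ltM {IHu} => [|y [|z u]] //=; first by rewrite ?ltn0 ?andbF.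
by move=> /andP[-> _] /andP[-> _].
Qed.

Lemma avoids_123_final_rise (u : seq nat) (m M : nat) :
  all (gtn m) u -> m < M -> avoids_123 (u ++ [:: m; M]) = nilp u.
Proof.
case/lastP: u => [|u x].
  by rewrite !avoids_123_cons /= ?ltn0 ?andbF avoids_123_nil.
rewrite all_rcons => /andP[/= lt_xm _] lt_mM; rewrite cat_rcons.
rewrite /nilp size_rcons; apply/negbTE/negP => /avoids_123_catr.
by rewrite avoids_123_cons /= lt_xm lt_mM.
Qed.

(** * Cutting a word at its maximum *)

(** The bound [N], which exceeds every letter in ['I_N], is the infinite letter
    put at the end of each arrangement of [A]. *)
Definition words N (A : {set 'I_N}) : seq (seq 'I_N) :=
  [seq t <- permutations (enum A) | avoids_123 (rcons (map val t) N)].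
Definition nwords N (A : {set 'I_N}) : nat := size (words A).

Lemma mem_arrangements (T : finType) (A : {set T}) (t : seq T) :
  (t \in permutations (enum A)) = uniq t && ([set x in t] == A).
Proof.
rewrite mem_permutations; apply/idP/andP => [eqtA|[uniq_t /eqP eqtA]].
  split; first by rewrite (perm_uniq eqtA) enum_uniq.
  by apply/eqP/setP => x; rewrite inE (perm_mem eqtA) mem_enum.
by apply: uniq_perm => // [|x]; rewrite ?enum_uniq // mem_enum -eqtA inE.
Qed.

Lemma mem_words N (A : {set 'I_N}) (t : seq 'I_N) :
  (t \in words A) =
  [&& avoids_123 (rcons (map val t) N), uniq t & [set x in t] == A].
Proof. by rewrite mem_filter mem_arrangements. Qed.

Lemma words_uniq N (A : {set 'I_N}) : uniq (words A).
Proof. by rewrite filter_uniq ?permutations_uniq. Qed.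

Lemma nwords0 N : nwords (set0 : {set 'I_N}) = 1.
Proof.
by rewrite /nwords /words enum_set0 /= avoids_123_cons avoids_123_nil.
Qed.

Lemma all_val_lt N (t : seq 'I_N) : all (gtn N) (map val t).
Proof. by apply/allP => _ /mapP[i _ ->]; exact: ltn_ord. Qed.

(** The last condition excludes [x < m < N], which arises when [v] is empty and
    [x] is the last letter of [u]; when [v] is nonempty, [m] starts a descent. *)
Lemma avoids_123_cut N (u v : seq 'I_N) (m : 'I_N) :
  all (gtn m) (map val u) -> all (gtn m) (map val v) ->
  avoids_123 (rcons (map val (u ++ m :: v)) N) =
  [&& avoids_123 (rcons (map val u) N), avoids_123 (rcons (map val v) N)
    & nilp v ==> nilp u].
Proof.
move=> lt_um lt_vm; rewrite map_cat rcons_cat /=.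
case: v lt_vm => [_|y v /andP[/= lt_ym _]] /=.
  rewrite avoids_123_final_rise ?ltn_ord // avoids_123_cons /= ?ltn0 ?andbF.
  rewrite /nilp size_map; case: u {lt_um} => [|x u] /=; last by rewrite !andbF.
  by rewrite avoids_123_cons /= ?ltn0 ?andbF avoids_123_nil.
rewrite avoids_123_descent // (avoids_123_rcons_max lt_um (all_val_lt u)).
by rewrite andbT.
Qed.

Section CutAtMaximum.

Variables (N : nat) (A : {set 'I_N}) (m : 'I_N).
Hypothesis lt_Am : {in A, forall x : 'I_N, x < m}.

Let prefix_set (t : seq 'I_N) : {set 'I_N} := [set x in take (seq.index m t) t].

Lemma max_notin : m \notin A.
Proof. by apply/negP => /lt_Am; rewrite ltnn. Qed.

(** Arrangements of [m |: A] in which [B] is the set of letters before [m]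
    correspond to pairs of arrangements of [B] and of its complement in [A].
    The condition on [B] rephrases, in terms of letter sets, that [v] may be
    empty only if [u] is. *)
Lemma words_cut (u v : seq 'I_N) (B : {set 'I_N}) : B \subset A ->
  (u ++ m :: v \in words (m |: A)) && (prefix_set (u ++ m :: v) == B) =
  [&& u \in words B, v \in words (A :\: B) & (B == A) ==> (A == set0)].
Proof.
move=> sBA; rewrite !mem_words.
have mA := max_notin.
have [uniq_t|] := boolP (uniq (u ++ m :: v)); last first.
  rewrite andbF /= => not_uniq; apply/esym/negbTE; apply: contra not_uniq.
  case/and3P=> /and3P[_ uniq_u /eqP eq_u] /and3P[_ uniq_v /eqP eq_v] _.
  have memu x : (x \in u) = (x \in B) by rewrite -eq_u inE.
  have memv x : (x \in v) = (x \notin B) && (x \in A) by rewrite -in_setD -eq_v inE.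
  rewrite cat_uniq uniq_u /= memu memv uniq_v (negbTE mA) andbF /= andbT negb_or.
  rewrite (contra (subsetP sBA m) mA) /=; apply/hasPn => x.
  by rewrite memv memu => /andP[].
move: (uniq_t); rewrite cat_uniq /= negb_or.
case/and4P=> uniq_u /andP[mu /hasPn uv] mv uniq_v.
rewrite uniq_u uniq_v /prefix_set index_cat (negbTE mu) /= eqxx addn0.
rewrite take_size_cat //= -!andbA.
have -> : ([set x in u ++ m :: v] == m |: A) && ([set x in u] == B) =
          ([set x in u] == B) && ([set x in v] == A :\: B).
  rewrite andbC; case: eqP => //= eq_u.
  have memu x : (x \in u) = (x \in B) by rewrite -eq_u inE.
  apply/eqP/eqP => [/setP eq_t|/setP eq_v]; apply/setP => x.
    have := eq_t x; rewrite !inE mem_cat inE -memu.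
    have [->|neq_xm] /= := eqVneq x m; first by rewrite (negbTE mv) (negbTE mA) andbF.
    have [xu|xu] /= := boolP (x \in u); last by [].
    by move=> _; apply/negbTE; apply: contraL xu => /uv.
  have := eq_v x; rewrite !inE mem_cat inE -memu.
  have [->|neq_xm] /= := eqVneq x m; first by rewrite orbT.
  have [xu|xu] /= := boolP (x \in u); last by [].
  by move=> _; rewrite (subsetP sBA) // -memu.
case: eqP => [eq_u|_]; rewrite ?andbF //=.
case: eqP => [eq_v|_]; rewrite ?andbF //= ?andbT.
have lt_um : all (gtn m) (map val u).
  apply/allP => _ /mapP[x xu ->]; apply: lt_Am.
  by apply: (subsetP sBA); rewrite -eq_u inE.
have lt_vm : all (gtn m) (map val v).
  apply/allP => _ /mapP[x xv ->]; apply: lt_Am.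
  by apply: (subsetP (subsetDl A B)); rewrite -eq_v inE.
rewrite avoids_123_cut //; congr [&& _, _ & _].
have nil0 (w : seq 'I_N) : nilp w = ([set x in w] == set0).
  apply/nilP/eqP => [->|/setP w0]; first by apply/setP=> x; rewrite !inE.
  by case: w w0 => // x w /(_ x); rewrite !inE eqxx.
rewrite !nil0 eq_u eq_v setD_eq0 [B == A]eqEsubset sBA /=.
case: (boolP (A \subset B)) => //= sAB.
by have /eqP -> : B == A by rewrite eqEsubset sBA.
Qed.

Lemma words_cut_size (B : {set 'I_N}) : B \subset A ->
  \sum_(t <- words (m |: A) | prefix_set t == B) 1 =
  ((B == A) ==> (A == set0)) * (nwords B * nwords (A :\: B)).
Proof.
move=> sBA; rewrite -big_filter sum1_size.
pose cuts := if (B == A) ==> (A == set0) then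
  [seq u ++ m :: v | u <- words B, v <- words (A :\: B)] else [::].
have -> : ((B == A) ==> (A == set0)) * (nwords B * nwords (A :\: B)) = size cuts.
  by rewrite /cuts; case: ifP; rewrite ?size_allpairs ?mul1n.
apply: perm_size; apply: uniq_perm; first by rewrite filter_uniq ?words_uniq.
  rewrite /cuts; case: ifP => // _; apply: allpairs_uniq; rewrite ?words_uniq //.
  have notin_m (w : seq 'I_N) (C : {set 'I_N}) :
    C \subset A -> w \in words C -> m \notin w.
    rewrite mem_words => sCA /and3P[_ _ /eqP eq_w]; apply: contra max_notin => mw.
    by apply: (subsetP sCA); rewrite -eq_w inE.
  move=> _ _ /allpairsP[[u v] /= [u_in v_in ->]]
    /allpairsP[[u' v'] /= [u'_in v'_in ->]] /=.
  move=> eq_uv.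
  have: seq.index m (u ++ m :: v) = seq.index m (u' ++ m :: v') by rewrite eq_uv.
  rewrite !index_cat (negbTE (notin_m _ _ sBA u_in)) (negbTE (notin_m _ _ sBA u'_in)).
  rewrite /= eqxx !addn0 => eq_size.
  by move/eqP: eq_uv; rewrite eqseq_cat // eqseq_cons eqxx => /andP[/eqP -> /eqP ->].
move=> t; rewrite mem_filter andbC /cuts; apply/idP/idP => [t_in|].
  have mt : m \in t.
    case/andP: t_in; rewrite mem_words => /and3P[_ _ /eqP/setP/(_ m)].
    by rewrite !inE eqxx.
  case/path.splitPr: mt t_in => u v; rewrite words_cut // => /and3P[u_in v_in ->].
  by apply/allpairsP; exists (u, v).
case: ifP => // cond /allpairsP[[u v] /= [u_in v_in ->]].
by rewrite words_cut // u_in v_in.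
Qed.

(** The term [B = A] of the sum would count the pairs with [v] empty; they are
    [nwords A] in number and are lost unless [u] is empty too. The term
    [nwords A] stands on the left to avoid truncated subtraction. *)
Lemma nwords_cut_at_max :
  nwords (m |: A) + nwords A =
  \sum_(B : {set 'I_N} | B \subset A) nwords B * nwords (A :\: B) + (A == set0).
Proof.
rewrite {1}/nwords -sum1_size big_seq.
rewrite (partition_big prefix_set (fun B => B \subset A)) => [|t]; last first.
  rewrite mem_words => /and3P[_ uniq_t /eqP/setP eq_t]; apply/subsetP => x.
  rewrite inE => x_in; have := eq_t x; rewrite !inE (mem_take x_in).
  case: eqP => //= eq_xm _; move: x_in; rewrite eq_xm => /index_ltn.
  by rewrite ltnn.
rewrite (eq_bigr (fun B : {set 'I_N} =>
    ((B == A) ==> (A == set0)) * (nwords B * nwords (A :\: B)))); last first.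
  by move=> B sBA; rewrite -big_seq_cond words_cut_size.
rewrite (bigD1 A) //= [in RHS](bigD1 A) //= eqxx setDv nwords0 muln1.
rewrite (eq_bigr (fun B : {set 'I_N} => nwords B * nwords (A :\: B))).
  case: eqP => [->|_] /=; last by rewrite mul0n add0n addn0 addnC.
  by rewrite nwords0 mul1n addnAC.
by move=> B /andP[_ /negbTE ->]; rewrite mul1n.
Qed.

End CutAtMaximum.

(** * The recurrence for the number of words *)
Definition num_words (n : nat) : nat := nwords [set: 'I_n].

Lemma sum_over_subsets (T : finType) (A : {set T}) (f : nat -> nat) :
  \sum_(B : {set T} | B \subset A) f #|B| = \sum_(i < #|A|.+1) 'C(#|A|, i) * f i.
Proof.
rewrite (partition_big (fun B : {set T} => inord #|B| : 'I_#|A|.+1) xpredT) //=.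
apply: eq_bigr => i _.
rewrite -(cards_draws A i) -[X in X * f i]sum1_card big_distrl /=.
apply: eq_big => [B|B /andP[sBA /eqP <-]].
  rewrite inE; apply: andb_id2l => sBA.
  by rewrite -val_eqE /= inordK // ltnS subset_leq_card.
by rewrite mul1n inordK // ltnS subset_leq_card.
Qed.

(** Once [nwords] is known to depend only on the cardinality for sets of at most
    [n] letters, cutting at the maximum determines it for sets of [n.+1] letters.
    This gives the independence of the alphabet by induction, without
    relabelling any word. *)
Lemma nwords_recurrence (n : nat) :
  (forall k N (A : {set 'I_N}), k <= n -> #|A| = k -> nwords A = num_words k) ->
  forall N (A : {set 'I_N}), #|A| = n.+1 ->
  nwords A + num_words n =
  \sum_(i < n.+1) 'C(n, i) * (num_words i * num_words (n - i)) + (n == 0).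
Proof.
move=> IHn N A cardA.
have [x0 x0A] : exists x, x \in A by apply/card_gt0P; rewrite cardA.
have [m mA max_m] : exists2 m : 'I_N, m \in A & forall x, x \in A -> x <= m.
  by case: (arg_maxnP (@nat_of_ord N) x0A) => m; exists m.
set A' := A :\ m.
have cardA' : #|A'| = n by move: (cardsD1 m A); rewrite cardA mA => -[].
have lt_A'm : {in A', forall x : 'I_N, x < m}.
  move=> x; rewrite !inE => /andP[neq_xm xA].
  by rewrite ltn_neqAle neq_xm max_m.
rewrite -(setD1K mA) -/A' -(IHn n N A') // nwords_cut_at_max //.
rewrite -cards_eq0 cardA'; congr (_ + _).
have := sum_over_subsets A' (fun i => num_words i * num_words (n - i)).
rewrite cardA' => <-.
apply: eq_bigr => B sBA'; have leBn : #|B| <= n by rewrite -cardA' subset_leq_card.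
rewrite (IHn #|B|) // (IHn (n - #|B|)) ?leq_subr //.
by rewrite cardsD (setIidPr sBA') cardA'.
Qed.

Lemma nwords_card N (A : {set 'I_N}) : nwords A = num_words #|A|.
Proof.
move: {2}#|A| (leqnn #|A|) => n; elim: n N A => [|n IHn] N A.
  rewrite leqn0 cards_eq0 => /eqP ->; rewrite cards0 /num_words.
  have -> : [set: 'I_0] = set0 by apply/setP; case.
  by rewrite !nwords0.
rewrite leq_eqVlt ltnS => /orP[/eqP cardA|]; last exact: IHn.
have IH k M (B : {set 'I_M}) : k <= n -> #|B| = k -> nwords B = num_words k.
  by move=> lekn cardB; rewrite IHn ?cardB.
apply/eqP; rewrite -(eqn_add2r (num_words n)) cardA (nwords_recurrence IH) //.
by rewrite /num_words (nwords_recurrence IH) // cardsT card_ord.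
Qed.

Lemma num_words_recurrence (n : nat) :
  num_words n.+1 + num_words n =
  \sum_(i < n.+1) 'C(n, i) * (num_words i * num_words (n - i)) + (n == 0).
Proof.
apply: nwords_recurrence => [k N A _ <-|]; first exact: nwords_card.
by rewrite cardsT card_ord.
Qed.

(** * Circular permutations *)

(** Rotating [w M] to [v M u], where [w = u v], adds no increasing triple: the
    parts [v M] and [u] are factors of [w M], and [M] starts a descent if [u] is
    nonempty. *)
Lemma avoids_123_rot (w : seq nat) (M k : nat) : all (gtn M) w ->
  avoids_123 (rcons w M) -> avoids_123 (rot k (rcons w M)).
Proof.
move=> lt_wM av; have [lekw|ltwk] := leqP k (size w); last first.
  by rewrite rot_oversize ?size_rcons.
rewrite /rot drop_rcons // -[in take _ _]cats1 takel_cat // cat_rcons.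
rewrite avoids_123_peak; last by apply/allP => x /mem_take; exact: allP.
move: av; rewrite -{1}(cat_take_drop k w) rcons_cat => av.
rewrite (avoids_123_catr av); move: av; rewrite -cats1 catA cats1 -cats1.
by move/avoids_123_catl/avoids_123_catl.
Qed.

Lemma rot_rcons_inj (T : eqType) (w w' : seq T) (M : T) (k : nat) :
  M \notin w -> rot k (rcons w M) = rcons w' M -> w = w'.
Proof.
move=> wM; have [lekw|ltwk] := leqP k (size w); last first.
  by rewrite rot_oversize ?size_rcons // => /rcons_inj[].
rewrite /rot drop_rcons // -[in take _ _]cats1 takel_cat // cat_rcons.
have mem_tk := @mem_take k _ w; have := cat_take_drop k w.
case/lastP: (take k w) mem_tk => [_ /= -> |v y mem_vy _].
  by rewrite cats1 => /rcons_inj[].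
rewrite -rcons_cons -rcons_cat => /rcons_inj[_ eq_yM].
by case/negP: wM; apply: mem_vy; rewrite mem_rcons eq_yM mem_head.
Qed.

Definition word n (s : 'S_n) : seq 'I_n := [seq s i | i <- enum 'I_n].

Lemma one_lineE n (s : 'S_n) : one_line s = map val (word s).
Proof. by rewrite /word -map_comp. Qed.

Lemma word_perm_eq n (s : 'S_n) : perm_eq (word s) (enum 'I_n).
Proof.
apply: uniq_perm => [||x]; rewrite ?enum_uniq //.
  by rewrite map_inj_uniq ?enum_uniq //; exact: perm_inj.
rewrite mem_enum; apply/mapP; exists ((s^-1)%g x); rewrite ?mem_enum //.
by rewrite permKV.
Qed.

Lemma word_surj n (t : seq 'I_n) :
  perm_eq t (enum 'I_n) -> exists s : 'S_n, word s = t.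
Proof.
move=> eq_t; have /tuple_permP[s ->] : perm_eq t (ord_tuple n) by [].
by exists s; apply: eq_map => i; rewrite tnth_ord_tuple.
Qed.

Lemma word_inj n : injective (@word n).
Proof.
move=> s s' eq_ss'; apply/permP => i.
have /eq_in_map/(_ i) := eq_ss'; apply; exact: mem_enum.
Qed.

Lemma mem_rotationsP n (s s' : 'S_n) :
  reflect (exists k, word s' = rot k (word s)) (s' \in rotations s).
Proof.
have one_line_rot k : (one_line s' == rot k (one_line s)) = (word s' == rot k (word s)).
  by rewrite !one_lineE -map_rot (inj_eq (inj_map val_inj)).
rewrite inE; apply: (iffP existsP) => [[k]|[k eq_k]].
  by rewrite one_line_rot => /eqP; exists k.
have [ltkn|lenk] := ltnP k n.+1.
  by exists (Ordinal ltkn); rewrite one_line_rot eq_k.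
exists ord0; rewrite one_line_rot eq_k rot0 rot_oversize //.
by rewrite size_map size_enum_ord ltnW.
Qed.

Lemma rotations_eq n (s s' : 'S_n) :
  s' \in rotations s -> rotations s' = rotations s.
Proof.
case/mem_rotationsP=> k eq_s'; apply/setP => x.
have rotK k1 (r : 'S_n) : exists k2, word r = rot k2 (rot k1 (word r)).
  by exists (size (rot k1 (word r)) - k1); rewrite -{1}[word r](rotK k1).
have rotD k1 k2 (r : seq 'I_n) : exists k3, rot k1 (rot k2 r) = rot k3 r.
  have [le1|/ltnW gt1] := leqP k1 (size r); last first.
    by exists k2; rewrite rot_oversize ?size_rot.
  have [le2|/ltnW gt2] := leqP k2 (size r); last by exists k1; rewrite (rot_oversize gt2).
  by rewrite rot_add_mod //; eexists.
apply/mem_rotationsP/mem_rotationsP => -[j ->].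
  by rewrite eq_s'; apply: rotD.
have [i eq_s] := rotK k s; rewrite eq_s -eq_s'; exact: rotD.
Qed.

Lemma mem_rotations_refl n (s : 'S_n) : s \in rotations s.
Proof. by apply/mem_rotationsP; exists 0; rewrite rot0. Qed.

Lemma word_ord_max n (s : 'S_n.+1) :
  s ord_max = ord_max <-> exists t, word s = rcons t ord_max.
Proof.
rewrite /word enum_ordSr map_rcons; split=> [->|[t /rcons_inj[]//]].
by eexists.
Qed.

(** Here the largest letter [ord_max] of the alphabet takes the place of the
    infinite letter. *)
Lemma mem_words_max n (t : seq 'I_n.+1) :
  (t \in words [set~ ord_max]) =
  avoids_123 (map val (rcons t ord_max)) && perm_eq (rcons t ord_max) (enum 'I_n.+1).
Proof.
have -> : perm_eq (rcons t ord_max) (enum 'I_n.+1) =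
          uniq t && ([set x in t] == [set~ ord_max]).
  have -> : enum 'I_n.+1 = enum [set: 'I_n.+1] by apply: eq_enum => x; rewrite !inE.
  rewrite -mem_permutations mem_arrangements rcons_uniq -andbA andbCA.
  congr (_ && _).
  apply/andP/eqP=> [[tM /eqP/setP eq_t]|/setP eq_t].
    apply/setP => x; have := eq_t x; rewrite !inE mem_rcons inE.
    by have [->|] := eqVneq x ord_max => //=; rewrite (negbTE tM).
  have memt x : (x \in t) = (x != ord_max) by have := eq_t x; rewrite !inE.
  rewrite memt eqxx; split=> //; apply/eqP/setP => x.
  by rewrite !inE mem_rcons inE memt orbN.
rewrite mem_words; have [uniq_t|] := boolP (uniq t); rewrite ?andbF //=.
have [/eqP/setP eq_t|] := boolP (_ == _); rewrite ?andbF //= !andbT map_rcons.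
apply: avoids_123_rcons_max; first exact: all_val_lt.
apply/allP => _ /mapP[x xt ->] /=; have := eq_t x; rewrite !inE xt.
by rewrite ltn_neqAle -ltnS ltn_ord andbT => /esym.
Qed.

Lemma circular_avoids_123_rotations n (s : 'S_n.+1) : s ord_max = ord_max ->
  circular_avoids_123 (rotations s) = avoids_123 (one_line s).
Proof.
move=> /word_ord_max[t eq_s]; apply/forall_inP/idP => [av|av s'].
  exact: av (mem_rotations_refl s).
case/mem_rotationsP=> k eq_s'; rewrite -/(avoids_123 _) one_lineE eq_s' map_rot.
move: av; rewrite one_lineE eq_s map_rcons; apply: avoids_123_rot.
apply/allP => _ /mapP[x xt ->] /=; rewrite ltn_neqAle -ltnS ltn_ord andbT.
have := perm_uniq (word_perm_eq s); rewrite eq_s enum_uniq rcons_uniq.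
case/andP=> tM _; apply: contra tM => /eqP eq_x.
by have <- : x = ord_max by exact: val_inj.
Qed.

(** Each class contains exactly one permutation that fixes [ord_max], that is,
    whose one-line notation ends with the largest letter. *)
Lemma num_circular_avoiding_123S (n : nat) :
  num_circular_avoiding_123 n.+1 = num_words n.
Proof.
pose S := [set s : 'S_n.+1 | (s ord_max == ord_max) && avoids_123 (one_line s)].
have -> : num_circular_avoiding_123 n.+1 = #|[set rotations s | s in S]|.
  apply: eq_card => c; rewrite inE; apply/andP/imsetP => [[/imsetP[p _ ->] av]|].
    have: ord_max \in word p by rewrite (perm_mem (word_perm_eq p)) mem_enum.
    move/path.splitPr => split_p.
    have [u [v eq_p]] : exists u v, word p = u ++ ord_max :: v.
      by case: split_p => u v; exists u, v.
    have [s eq_s] : exists s : 'S_n.+1, word s = rot (size (rcons u ord_max)) (word p).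
      by apply: word_surj; rewrite perm_rot word_perm_eq.
    have /rotations_eq eq_rot : s \in rotations p.
      by apply/mem_rotationsP; eexists; exact: eq_s.
    have sM : s ord_max = ord_max.
      apply/word_ord_max; exists (v ++ u).
      by rewrite eq_s eq_p -cat_rcons rot_size_cat rcons_cat.
    exists s; last by rewrite eq_rot.
    by rewrite inE sM eqxx -circular_avoids_123_rotations // eq_rot.
  case=> s; rewrite inE => /andP[/eqP sM av] ->; split; first exact: imset_f.
  by rewrite circular_avoids_123_rotations.
rewrite card_in_imset => [|s s']; last first.
  rewrite !inE => /andP[/eqP/word_ord_max[t eq_s] _].
  case/andP=> /eqP/word_ord_max[t' eq_s'] _ eq_rot.
  have: s' \in rotations s by rewrite eq_rot mem_rotations_refl.
  case/mem_rotationsP=> k; rewrite eq_s eq_s' => /esym/rot_rcons_inj eq_t.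
  apply: word_inj; rewrite eq_s eq_s' eq_t //.
  by have := perm_uniq (word_perm_eq s); rewrite eq_s enum_uniq rcons_uniq => /andP[].
(* The words of these permutations are the arrangements of the letters other than
   [ord_max], with [ord_max] appended. *)
transitivity (nwords [set~ ord_max : 'I_n.+1]); last first.
  by rewrite nwords_card cardsC1 card_ord.
rewrite cardE -(size_map (@word _)) -[RHS](size_map (rcons^~ ord_max)).
apply: perm_size; apply: uniq_perm => [||w].
- by rewrite (map_inj_uniq (@word_inj _)) enum_uniq.
- by rewrite map_inj_uniq ?words_uniq // => t t' /rcons_inj[].
apply/mapP/mapP => -[].
  move=> s; rewrite mem_enum inE => /andP[/eqP sM av] ->.
  have [t eq_s] := (word_ord_max s).1 sM; exists t => //.
  by rewrite mem_words_max -eq_s -one_lineE av word_perm_eq.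
move=> t; rewrite mem_words_max => /andP[av /word_surj[s eq_s]] ->.
exists s => //; rewrite mem_enum inE one_lineE eq_s av andbT.
by apply/eqP/word_ord_max; exists t.
Qed.

(** * Exponential generating function *)
Import GRing.Theory Num.Theory.

Local Open Scope ring_scope.

Lemma D123E (n : nat) : D123 n = (num_words n)%:R / (n`!)%:R.
Proof.
rewrite /D123 /fps_deriv /C123_0 /egf num_circular_avoiding_123S factS natrM.
rewrite invfM mulrCA !mulrA mulfK //; first by rewrite pnatr_eq0.
Qed.

Theorem mainTheorem2 :
  fps_deriv D123 =1 (D123 * D123 - D123 + 1)%fps.
Proof.
move=> n; rewrite /fps_deriv /fps_add /fps_sub /fps_mul /fps_one !D123E.
have fact_neq0 k : (k`!)%:R != 0 :> rat by rewrite pnatr_eq0 -lt0n fact_gt0.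
apply: (mulfI (fact_neq0 n)).
have eq_n : (num_words n.+1)%:R = \sum_(i < n.+1)
    ('C(n, i) * (num_words i * num_words (n - i)))%:R
    + (n == 0)%:R - (num_words n)%:R :> rat.
  by apply: (canRL (addrK _)); rewrite -natrD num_words_recurrence natrD natr_sum.
have -> : (n`!)%:R * (n.+1%:R * ((num_words n.+1)%:R / (n.+1`!)%:R)) =
          (num_words n.+1)%:R :> rat.
  rewrite factS natrM mulrA [(n`!)%:R * _]mulrC mulrCA divff ?mulr1 //.
  by rewrite mulf_neq0 ?fact_neq0 ?pnatr_eq0.
rewrite eq_n mulrDr mulrBr mulr_sumr [in RHS]mulrCA divff // mulr1 addrAC.
congr (_ - _ + _); last by case: n {eq_n} => [|n]; rewrite ?mul1r ?mulr0.
apply: eq_bigr => i _; rewrite !D123E !natrM -(@bin_fact n i) -1?ltnS //.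
rewrite !natrM -mulrA; congr (_ * _).
by rewrite [X in _ = _ * X]mulrACA -invfM mulrCA divff ?mulr1 // mulf_neq0 ?fact_neq0.
Qed.
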